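(* Let $A,B,C$ be indeterminates, let $L$ be the linear functional on polynomials in $x$ defined by $L\bigl((x+A)_m\bigr)=\frac{(A)_m(B)_m}{(C)_m}$ for all $m\ge0$, and let $M_n(A,B,C)=L(x^n)$. Then, as formal power series in $t$, $$\sum_{n=0}^\infty M_n(A,B,C)t^n=\sum_{n=0}^\infty\frac{(A)_n(B)_n}{(C)_n}\,\frac{t^n}{\prod_{l=0}^n(1+(A+l)t)},$$ and $$\sum_{n=0}^\infty M_n(A,B,C)\frac{t^n}{n!}=e^{-At}\,{}_2F_1\left(\begin{array}{c}A,\ B\\ C\end{array};1-e^{-t}\right).$$
   Context: $(x)_n=x(x+1)\cdots(x+n-1)$, $(x)_0=1$; ${}_2F_1$ is the Gauss hypergeometric series. The functional $L$ is defined on polynomials in $x$ with coefficients in the field of rational functions in $A,B,C$ (it is linear over that field). *)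

(* Defs.v *)
From HB Require Import structures.
From mathcomp Require Import all_boot all_order all_algebra.
From mathcomp Require Import fraction.
From mathcomp Require Import boolp.
From mathcomp Require Import mpoly.

Set Implicit Arguments.
Unset Strict Implicit.
Unset Printing Implicit Defensive.

Import GRing.Theory.

Local Open Scope ring_scope.

(* (x)_n = x (x + 1) ... (x + n - 1) *)
Definition poch (R : pzRingType) (x : R) (n : nat) : R :=
  \prod_(i < n) (x + i%:R).

Definition ratfun3 (k : fieldType) := {fraction {mpoly k[3]}}.

Definition indet (k : fieldType) (i : 'I_3) : ratfun3 k := tofrac ('X_i).

(* Formal power series.  A wrapper around nat -> K, since the function type
   itself already carries the pointwise ring structure. *)
Record fps (K : fieldType) := Fps { fps_coef :> nat -> K }.

HB.instance Definition _ (K : fieldType) := gen_eqMixin (fps K).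
HB.instance Definition _ (K : fieldType) := gen_choiceMixin (fps K).

Section FpsRing.
Variable K : fieldType.
Implicit Types (f g h : fps K) (a b : K).

Lemma fpsP f g : f =1 g <-> f = g.
Proof. by split=> [|-> //]; case: f g => f [g] /= /funext ->. Qed.

Definition fps_zero : fps K := Fps (fun=> 0).
Definition fps_opp f : fps K := Fps (fun n => - f n).
Definition fps_add f g : fps K := Fps (fun n => f n + g n).

Fact fps_addA : associative fps_add.
Proof. by move=> f g h; apply/fpsP => n; apply: addrA. Qed.
Fact fps_addC : commutative fps_add.
Proof. by move=> f g; apply/fpsP => n; apply: addrC. Qed.
Fact fps_add0 : left_id fps_zero fps_add.
Proof. by move=> f; apply/fpsP => n; apply: add0r. Qed.
Fact fps_addN : left_inverse fps_zero fps_opp fps_add.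
Proof. by move=> f; apply/fpsP => n; apply: addNr. Qed.

HB.instance Definition _ :=
  GRing.isZmodule.Build (fps K) fps_addA fps_addC fps_add0 fps_addN.

Definition fps_one : fps K := Fps (fun n => (n == 0)%:R).
Definition fps_mul f g : fps K :=
  Fps (fun n => \sum_(i < n.+1) f i * g (n - i)%N).

Let trunc f N : {poly K} := \poly_(i < N) f i.

Let coef_trunc f N n : (n < N)%N -> (trunc f N)`_n = f n.
Proof. by move=> ltnN; rewrite coef_poly ltnN. Qed.

Let fps_mulE f g N n :
  (n < N)%N -> fps_mul f g n = (trunc f N * trunc g N)`_n.
Proof.
move=> ltnN; rewrite coefM; apply: eq_bigr => i _.
rewrite !coef_trunc //; first by apply: leq_ltn_trans (leq_subr _ _) ltnN.
by apply: leq_trans (ltn_ord i) ltnN.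
Qed.

Fact fps_mulC : commutative fps_mul.
Proof.
by move=> f g; apply/fpsP => n; rewrite !(@fps_mulE _ _ n.+1) // mulrC.
Qed.

Fact fps_mulA : associative fps_mul.
Proof.
move=> f g h; apply/fpsP => n.
transitivity ((trunc f n.+1 * (trunc g n.+1 * trunc h n.+1))`_n).
  rewrite coefM; apply: eq_bigr => i _; rewrite coef_trunc //.
  by rewrite -fps_mulE // ltnS leq_subr.
rewrite mulrA coefM; apply: eq_bigr => i _.
by rewrite -fps_mulE // coef_trunc // ltnS leq_subr.
Qed.

Fact fps_mul1 : left_id fps_one fps_mul.
Proof.
move=> f; apply/fpsP => n /=.
by rewrite big_ord_recl /= subn0 mul1r big1 ?addr0 // => i _; rewrite mul0r.
Qed.

Fact fps_mulDl : left_distributive fps_mul fps_add.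
Proof.
move=> f g h; apply/fpsP => n /=; rewrite -big_split /=.
by apply: eq_bigr => i _; rewrite mulrDl.
Qed.

Fact fps_one_neq0 : fps_one != 0.
Proof.
by apply/eqP => /fpsP/(_ 0)/eqP; rewrite /= oner_eq0.
Qed.

HB.instance Definition _ := GRing.Zmodule_isComNzRing.Build (fps K)
  fps_mulA fps_mulC fps_mul1 fps_mulDl fps_one_neq0.

Definition fps_scale a f : fps K := Fps (fun n => a * f n).

Fact fps_scaleA a b f : fps_scale a (fps_scale b f) = fps_scale (a * b) f.
Proof. by apply/fpsP => n; apply: mulrA. Qed.
Fact fps_scale1 : left_id 1 fps_scale.
Proof. by move=> f; apply/fpsP => n; apply: mul1r. Qed.
Fact fps_scaleDr : right_distributive fps_scale +%R.
Proof. by move=> a f g; apply/fpsP => n; apply: mulrDr. Qed.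
Fact fps_scaleDl f : {morph fps_scale^~ f : a b / a + b}.
Proof. by move=> a b; apply/fpsP => n; apply: mulrDl. Qed.

HB.instance Definition _ := GRing.Zmodule_isLmodule.Build K (fps K)
  fps_scaleA fps_scale1 fps_scaleDr fps_scaleDl.

Fact fps_scaleAl a f g : a *: (f * g) = (a *: f) * g.
Proof.
apply/fpsP => n /=; rewrite mulr_sumr.
by apply: eq_bigr => i _; rewrite mulrA.
Qed.

HB.instance Definition _ :=
  GRing.Lmodule_isLalgebra.Build K (fps K) fps_scaleAl.
HB.instance Definition _ := GRing.Lalgebra_isComAlgebra.Build K (fps K).

Lemma fps_coef0 n : (0 : fps K) n = 0. Proof. by []. Qed.
Lemma fps_coef1 n : (1 : fps K) n = (n == 0)%:R. Proof. by []. Qed.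
Lemma fps_coefD f g n : (f + g) n = f n + g n. Proof. by []. Qed.
Lemma fps_coefN f n : (- f) n = - f n. Proof. by []. Qed.
Lemma fps_coefB f g n : (f - g) n = f n - g n. Proof. by []. Qed.
Lemma fps_coefZ a f n : (a *: f) n = a * f n. Proof. by []. Qed.
Lemma fps_coefM f g n : (f * g) n = \sum_(i < n.+1) f i * g (n - i)%N.
Proof. by []. Qed.
Lemma fps_coef_sum (I : Type) (r : seq I) (P : pred I) (F : I -> fps K) n :
  (\sum_(i <- r | P i) F i) n = \sum_(i <- r | P i) F i n.
Proof. by elim/big_rec2: _ => // i _ f _ <-. Qed.

Lemma fps_coef0M f g : (f * g) 0%N = f 0%N * g 0%N.
Proof. by rewrite fps_coefM big_ord1. Qed.

Lemma fps_coefX_small g m n : g 0%N = 0 -> (n < m)%N -> (g ^+ m) n = 0.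
Proof.
move=> g0; elim: m n => // m IHm n ltnm; rewrite exprS fps_coefM.
apply: big1 => -[[|i] /= lein] _; first by rewrite g0 mul0r.
by rewrite IHm ?mulr0 //; case: n lein ltnm => // n *; rewrite subSS
  (leq_ltn_trans (leq_subr _ _)).
Qed.

(* f^-1 = f_0^-1 * \sum_m (1 - f_0^-1 f)^m, where the terms with m > n do not
   contribute to the coefficient of t^n. *)
Definition fps_unit : {pred fps K} := [pred f | fps_coef f 0%N != 0].
Definition fps_inv f : fps K :=
  if f \in fps_unit then
    Fps (fun n => (f 0%N)^-1 *
                  \sum_(m < n.+1) ((1 - (f 0%N)^-1 *: f) ^+ m : fps K) n)
  else f.

Fact fps_mulVx : {in fps_unit, left_inverse 1 fps_inv *%R}.
Proof.
move=> f fU; rewrite /fps_inv fU; move: fU; rewrite inE => f0.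
set u := 1 - (f 0%N)^-1 *: f.
have u0 : u 0%N = 0 by rewrite /u fps_coefB fps_coefZ mulVf ?subrr.
have fE : (f 0%N)^-1 *: f = 1 - u by rewrite /u opprB addrC subrK.
apply/fpsP => n; rewrite fps_coefM.
transitivity (((\sum_(m < n.+1) u ^+ m) * ((f 0%N)^-1 *: f)) n).
  rewrite fps_coefM; apply: eq_bigr => -[i /= lein] _.
  rewrite [RHS]mulrCA mulrA; congr (_ * _ * _).
  rewrite fps_coef_sum -(subnKC lein).
  rewrite [in RHS]big_split_ord /= [X in _ + X]big1 ?addr0 // => j _.
  by rewrite fps_coefX_small // addSn ltnS leq_addr.
rewrite fE mulrC -opprB mulNr -subrX1 opprB fps_coefB.
by rewrite fps_coefX_small // subr0.
Qed.

Fact fps_unitPl f g : g * f = 1 -> fps_unit f.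
Proof.
move/fpsP/(_ 0%N); rewrite fps_coef0M /fps_unit /= => gf1.
by apply/eqP => f0; move/eqP: gf1; rewrite f0 mulr0 eq_sym oner_eq0.
Qed.

Fact fps_inv_out : {in [predC fps_unit], fps_inv =1 id}.
Proof. by move=> f /negPf fU; rewrite /fps_inv; case: ifP => //; rewrite fU. Qed.

HB.instance Definition _ := GRing.ComNzRing_hasMulInverse.Build (fps K)
  fps_mulVx fps_unitPl fps_inv_out.

Lemma fps_unitE f : (f \is a GRing.unit) = (f 0%N != 0).
Proof. by []. Qed.

(* The indeterminate t. *)
Definition fpsX : fps K := Fps (fun n => (n == 1)%:R).

(* S is the sum of the series \sum_n F n in the t-adic topology. *)
Definition fps_hassum (F : nat -> fps K) (S : fps K) : Prop :=
  forall j, exists N, forall n, (N <= n)%N -> (\sum_(i < n) F i) j = S j.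

(* Composition f(g(t)) = \sum_n f_n g(t)^n.  It is meaningful only if g has
   zero constant term: the terms with n > j then do not contribute to the
   coefficient of t^j. *)
Definition fps_comp f g : fps K :=
  Fps (fun j => \sum_(n < j.+1) f n * (g ^+ n) j).

Lemma fps_compP f g :
  g 0%N = 0 -> fps_hassum (fun n => f n *: g ^+ n) (fps_comp f g).
Proof.
move=> g0 j; exists j.+1 => n lejn; rewrite fps_coef_sum /=.
rewrite -(subnKC lejn) big_split_ord /= [X in _ + X]big1 ?addr0 // => i _.
by rewrite fps_coefX_small ?mulr0 // addSn ltnS leq_addr.
Qed.

(* e^{a t} *)
Definition fps_exp a : fps K := Fps (fun n => a ^+ n / n`!%:R).

Definition hyp2F1 a b c : fps K :=
  Fps (fun n => poch a n * poch b n / (poch c n * n`!%:R)).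

End FpsRing.

Arguments fpsX {K}.

(* Main.v *)
Require Import Defs.
From HB Require Import structures.
From mathcomp Require Import all_boot all_order all_algebra.
From mathcomp Require Import fraction ring.
From mathcomp Require Import mpoly.

(** The powers of [x] expand on the basis [(x + a)_m] with coefficients
[S(n, m)], a shifted, signed form of the Stirling numbers of the second kind:
since [x (x + a)_m = (x + a)_(m+1) - (a + m) (x + a)_m], they are given by
[S(0, m) = [m = 0]] and [S(n+1, m) = S(n, m-1) - (a + m) S(n, m)]
([expX_stirling]).  Applying [L] gives
[L(x^n) = \sum_m S(n, m) L((x + a)_m)], so both formulas amount to a
generating function in [n] of the column [m] of this array.

- The ordinary one is [t^m / \prod_(l <= m) (1 + (a + l) t)]: multiplying it
  by [1 + (a + m) t] gives [t] times the one of the column [m - 1], which is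
  the recurrence ([stirling_ogf_coef]).
- The exponential one is [e^(-at) (1 - e^(-t))^m / m!]: for [y = 1 - e^(-t)],
  [y' = 1 - y], so that the derivative of [P_m = e^(-at) y^m] is
  [m P_(m-1) - (a + m) P_m], which is again the recurrence, up to the factors
  [m!] and [n!] ([stirling_egf_coef]).

The values [L((x + a)_m) = (A)_m (B)_m / (C)_m] are arbitrary weights in this
argument; they give the hypergeometric coefficients after division by [m!]. *)

Set Implicit Arguments.
Unset Strict Implicit.
Unset Printing Implicit Defensive.

Import GRing.Theory.

Local Open Scope ring_scope.

(** * Powers on the basis of rising factorials *)

Lemma pochS (R : pzRingType) (x : R) n : poch x n.+1 = poch x n * (x + n%:R).
Proof. by rewrite /poch big_ord_recr. Qed.

(** Column [m] starts with the diagonal entry [1] in row [m]. With [a = 0] and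
without the sign this is the usual triangle of Stirling numbers of the second
kind. *)
Fixpoint stirling (K : pzRingType) (a : K) (n m : nat) : K :=
  if n is n'.+1 then
    (if m is m'.+1 then stirling a n' m' else 0)
      - (a + m%:R) * stirling a n' m
  else (m == 0)%:R.

Lemma stirling_small (K : pzRingType) (a : K) n m :
  (n < m)%N -> stirling a n m = 0.
Proof.
elim: n m => [|n IHn] [|m] //= ltnm.
by rewrite !IHn ?mulr0 ?subr0 //; apply: ltnW.
Qed.

Lemma mulX_poch (K : fieldType) (a : K) m :
  'X * poch ('X + a%:P) m
  = poch ('X + a%:P) m.+1 - (a + m%:R) *: poch ('X + a%:P) m.
Proof. by rewrite pochS -mul_polyC polyCD polyC_natr; ring. Qed.

(** The bound [N] is free because the terms with [m > n] vanish. *)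
Lemma expX_stirling (K : fieldType) (a : K) n N : (n < N)%N ->
  'X^n = \sum_(m < N) stirling a n m *: poch ('X + a%:P) m.
Proof.
elim: n N => [|n IHn] [|N] // ltnN.
  rewrite big_ord_recl /= scale1r big1 => [|i _]; last by rewrite scale0r.
  by rewrite addr0 /poch big_ord0 expr0.
rewrite exprS (IHn N) // mulr_sumr.
under eq_bigr => m _ do rewrite -scalerAr mulX_poch scalerBr.
under [RHS]eq_bigr => m _ do rewrite /= scalerBl.
rewrite !sumrB; congr (_ - _).
  by rewrite [RHS]big_ord_recl /= scale0r add0r.
rewrite [RHS]big_ord_recr /= stirling_small // mulr0 scale0r addr0.
by apply: eq_bigr => m _; rewrite scalerA mulrC.
Qed.

Lemma linear_expX_stirling (K : fieldType) (L : {scalar {poly K}}) (a : K) n N :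
  (n < N)%N ->
  L 'X^n = \sum_(m < N) stirling a n m * L (poch ('X + a%:P) m).
Proof.
move=> ltnN; rewrite (expX_stirling a ltnN) linear_sum.
by apply: eq_bigr => m _; rewrite linearZ.
Qed.

(** * The ordinary generating function of a column *)

Lemma fps_coef0XM (K : fieldType) (f : fps K) : (fpsX * f) 0%N = 0.
Proof. by rewrite fps_coef0M mul0r. Qed.

Lemma fps_coefSXM (K : fieldType) (f : fps K) n : (fpsX * f) n.+1 = f n.
Proof.
rewrite fps_coefM big_ord_recl /= mul0r add0r big_ord_recl /= mul1r subSS subn0.
by rewrite big1 ?addr0 // => i _; rewrite mul0r.
Qed.

Lemma fps_unit_1DXM (K : fieldType) (a : K) :
  1 + a *: fpsX \is a @GRing.unit (fps K).
Proof. by rewrite fps_unitE fps_coefD fps_coefZ mulr0 addr0 oner_eq0. Qed.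

Definition stirling_ogf (K : fieldType) (a : K) m : fps K :=
  fpsX ^+ m / \prod_(l < m.+1) (1 + (a + l%:R) *: fpsX).

Lemma stirling_ogf0 (K : fieldType) (a : K) :
  stirling_ogf a 0 * (1 + (a + 0%:R) *: fpsX) = 1.
Proof. by rewrite /stirling_ogf big_ord1 mul1r mulVr ?fps_unit_1DXM. Qed.

Lemma stirling_ogfS (K : fieldType) (a : K) m :
  stirling_ogf a m.+1 * (1 + (a + m.+1%:R) *: fpsX) = fpsX * stirling_ogf a m.
Proof.
have U i : \prod_(l < i) (1 + (a + l%:R) *: fpsX) \is a @GRing.unit (fps K).
  by elim/big_ind: _ => *; rewrite ?unitr1 ?unitrMl ?fps_unit_1DXM.
rewrite /stirling_ogf [in LHS]big_ord_recr /= invrM ?U ?fps_unit_1DXM //.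
by rewrite exprS -!mulrA [in X in _ * (_ * X)]mulrC mulrA mulrA mulrK
  ?fps_unit_1DXM // -mulrA.
Qed.

(** Coefficient extraction from the two preceding identities: multiplying by
[1 + b t] adds [b] times the previous coefficient, so they are the recurrence
which defines [stirling]. *)
Lemma stirling_ogf_coef (K : fieldType) (a : K) m n :
  stirling_ogf a m n = stirling a n m.
Proof.
have coefE (f : fps K) b j : (f * (1 + b *: fpsX)) j
    = f j + b * (if j is j'.+1 then f j' else 0).
  rewrite mulrDr mulr1 -scalerAr mulrC fps_coefD fps_coefZ.
  by case: j => [|j]; rewrite ?fps_coef0XM ?fps_coefSXM.
elim: n m => [|n IHn] [|m].
- by move/fpsP/(_ 0%N): (stirling_ogf0 a); rewrite coefE mulr0 addr0.
- by move/fpsP/(_ 0%N): (stirling_ogfS a m);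
    rewrite coefE mulr0 addr0 fps_coef0XM.
- move/fpsP/(_ n.+1): (stirling_ogf0 a); rewrite coefE IHn fps_coef1 /=.
  by move/eqP; rewrite addr_eq0 => /eqP ->; rewrite add0r.
- move/fpsP/(_ n.+1): (stirling_ogfS a m); rewrite coefE fps_coefSXM !IHn /=.
  by move=> <-; rewrite addrK.
Qed.

(** * The exponential generating function of a column *)

Definition fps_deriv (K : fieldType) (f : fps K) : fps K :=
  Fps (fun n => n.+1%:R * f n.+1).

(** In degree [n + 1] the factor [n + 1] is split as [i + (n + 1 - i)] on the
term [f_i g_(n + 1 - i)]. *)
Lemma fps_derivM (K : fieldType) (f g : fps K) :
  fps_deriv (f * g) = fps_deriv f * g + f * fps_deriv g.
Proof.
apply/fpsP => n; rewrite fps_coefD !fps_coefM /= mulr_sumr.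
transitivity (\sum_(i < n.+2) (i%:R * f i * g (n.+1 - i)%N)
  + \sum_(i < n.+2) f i * ((n.+1 - i)%:R * g (n.+1 - i)%N)).
  rewrite -big_split; apply: eq_bigr => i _ /=.
  have -> : n.+1%:R = i%:R + (n.+1 - i)%:R :> K.
    by rewrite -natrD subnKC // -ltnS.
  by ring.
rewrite [X in X + _]big_ord_recl [X in _ + X]big_ord_recr /=.
rewrite subnn !mul0r mulr0 add0r addr0; congr (_ + _).
by apply: eq_bigr => i _; rewrite subSn // -ltnS.
Qed.

Lemma fps_deriv1B (K : fieldType) (f : fps K) :
  fps_deriv (1 - f) = - fps_deriv f.
Proof. by apply/fpsP => n /=; rewrite sub0r mulrN. Qed.

Lemma fps_deriv_exp (K : fieldType) (a : K) : [pchar K] =i pred0 ->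
  fps_deriv (fps_exp a) = a *: fps_exp a.
Proof.
move=> /pcharf0P K0; apply/fpsP => n /=.
by rewrite factS natrM exprS; field; rewrite nat1r !K0 -lt0n fact_gt0.
Qed.

Lemma fps_coef0_1Bexp (K : fieldType) (a : K) : (1 - fps_exp a) 0%N = 0.
Proof. by rewrite fps_coefB /= fact0 expr0 divr1 subrr. Qed.

(** Divided by [m!], this is the recurrence of [stirling] for the series
[e^(-at) y^m / m!], whose derivative shifts the row by one.  It rests on
[y' = 1 - y].  For [m = 0] the term with [m.-1] has the factor [0]. *)
Lemma fps_deriv_stirling_egf (K : fieldType) (a : K) m : [pchar K] =i pred0 ->
  let y : fps K := 1 - fps_exp (-1) in
  fps_deriv (fps_exp (- a) * y ^+ m)
  = m%:R *: (fps_exp (- a) * y ^+ m.-1)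
    - (a + m%:R) *: (fps_exp (- a) * y ^+ m).
Proof.
move=> K0 y.
have Dy : fps_deriv y = 1 - y.
  by rewrite fps_deriv1B fps_deriv_exp // scaleN1r opprK /y subKr.
elim: m => [|m IHm].
  by rewrite expr0 mulr1 fps_deriv_exp // scale0r sub0r addr0 scaleNr.
rewrite exprSr mulrA fps_derivM IHm Dy mulrBl -!scalerAl.
have -> : m%:R *: (fps_exp (- a) * y ^+ m.-1 * y)
    = m%:R *: (fps_exp (- a) * y ^+ m).
  by case: m {IHm} => [|m]; rewrite ?scale0r // [in RHS]exprSr mulrA.
rewrite [m.+1.-1]/=; set P := fps_exp (- a) * y ^+ m.
rewrite -natr1 [a + (_ + _)]addrA [P * (1 - y)]mulrBr mulr1.
by move: (a + _) => c; rewrite !scalerDl !scale1r addrACA -opprD.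
Qed.

(** [P_m = e^(-at) (1 - e^(-t))^m] is [m!] times the exponential generating
function of the column [m]. *)
Lemma stirling_egf_coef (K : fieldType) (a : K) m n : [pchar K] =i pred0 ->
  n`!%:R * (fps_exp (- a) * (1 - fps_exp (-1)) ^+ m) n
  = m`!%:R * stirling a n m.
Proof.
move=> K0; set P := fun m => fps_exp (- a) * (1 - fps_exp (-1)) ^+ m.
rewrite -/(P m); elim: n m => [|n IHn] m.
  rewrite /P mul1r fps_coef0M /= expr0 fact0 divr1 mul1r.
  case: m => [|m]; last by rewrite fps_coefX_small ?fps_coef0_1Bexp ?mulr0.
  by rewrite expr0 fps_coef1 mul1r.
have -> : n.+1`!%:R * P m n.+1 = n`!%:R * fps_deriv (P m) n.
  by rewrite factS mulnC natrM /= mulrA.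
rewrite fps_deriv_stirling_egf // -/(P m) -/(P m.-1) fps_coefB !fps_coefZ.
rewrite mulrBr mulrCA IHn [X in _ - X]mulrCA IHn.
case: m => [|m] /=; first by rewrite mul0r; ring.
by rewrite factS natrM; ring.
Qed.

Lemma fps_coefM_comp (K : fieldType) (f g h : fps K) n : g 0%N = 0 ->
  (h * fps_comp f g) n = \sum_(m < n.+1) f m * (h * g ^+ m) n.
Proof.
move=> g0; rewrite fps_coefM.
under [RHS]eq_bigr => m _ do rewrite fps_coefM mulr_sumr.
rewrite exchange_big; apply: eq_bigr => i _ /=.
have le_in : ((n - i).+1 <= n.+1)%N by rewrite ltnS leq_subr.
rewrite (big_ord_widen _ (fun m => f m * (g ^+ m) (n - i)%N) le_in).
rewrite mulr_sumr big_mkcond; apply: eq_bigr => m _ /=.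
case: ifPn => [_|]; first by rewrite mulrCA.
by rewrite ltnS -ltnNge => lt_m; rewrite fps_coefX_small ?mulr0.
Qed.

(** * Moments *)

Section Moments.

Variables (K : fieldType) (L : {scalar {poly K}}) (a : K) (w : nat -> K).
Hypothesis Lw : forall m, L (poch ('X + a%:P) m) = w m.

Lemma moments_ogf :
  fps_hassum (fun m => w m *: stirling_ogf a m) (Fps (fun n => L 'X^n)).
Proof.
move=> n; exists n.+1 => N ltnN; rewrite fps_coef_sum [RHS]/=.
rewrite (linear_expX_stirling L a ltnN); apply: eq_bigr => m _.
by rewrite fps_coefZ stirling_ogf_coef Lw mulrC.
Qed.

Lemma moments_egf : [pchar K] =i pred0 ->
  Fps (fun n => L 'X^n / n`!%:R)
  = fps_exp (- a) * fps_comp (Fps (fun m => w m / m`!%:R)) (1 - fps_exp (-1)).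
Proof.
move=> K0; apply/fpsP => n; rewrite fps_coefM_comp ?fps_coef0_1Bexp // [LHS]/=.
have fact_neq0 j : j`!%:R != 0 :> K.
  by move/pcharf0P: K0 => ->; rewrite -lt0n fact_gt0.
rewrite (linear_expX_stirling L a (ltnSn n)) mulr_suml.
apply: eq_bigr => m _; rewrite Lw /=.
apply: (mulfI (fact_neq0 n)); rewrite [RHS]mulrCA stirling_egf_coef //.
by field; rewrite !fact_neq0.
Qed.

End Moments.

(** Constants embed in the polynomials, and these in their fractions. *)
Lemma pchar_ratfun3 (k : fieldType) :
  [pchar k] =i pred0 -> [pchar (ratfun3 k)] =i pred0.
Proof.
move=> /pcharf0P k0; apply/pcharf0P => n.
by rewrite -(rmorph_nat (@tofrac _)) tofrac_eq0 -mpolyC_nat mpolyC_eq0 k0.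
Qed.

Theorem proposition15 (k : fieldType) (k_char0 : [pchar k] =i pred0)
    (L : {scalar {poly (ratfun3 k)}}) :
  let A : ratfun3 k := indet k 0 in
  let B : ratfun3 k := indet k 1 in
  let C : ratfun3 k := indet k 2 in
  let M (n : nat) : ratfun3 k := L ('X^n) in
  (forall m : nat,
     L (poch ('X + A%:P) m) = poch A m * poch B m / poch C m) ->
  fps_hassum
    (fun n => (poch A n * poch B n / poch C n) *:
                (fpsX ^+ n / \prod_(l < n.+1) (1 + (A + l%:R) *: fpsX)))
    (Fps M)
  /\
  Fps (fun n => M n / n`!%:R)
  = fps_exp (- A) * fps_comp (hyp2F1 A B C) (1 - fps_exp (-1)).
Proof.
move=> A B C M LE; split; first exact: moments_ogf LE.
rewrite (moments_egf LE (pchar_ratfun3 k_char0)).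
congr (_ * fps_comp _ _); apply/fpsP => m /=.
by rewrite invfM mulrA.
Qed.
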